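(* Let $\tau_1:E_1\to Q_1$ and $\tau_2:E_2\to Q_2$ be Lie algebroids and let $\Psi:E_1\to E_2$ be a morphism of Lie algebroids which is fiberwise bijective. Given a SODE vector field $\Gamma_2$ on the Lie algebroid $E_2$, there exists a unique SODE vector field $\Gamma_1$ on the Lie algebroid $E_1$ such that $T\Psi\circ\Gamma_1=\Gamma_2\circ\Psi$.
   Context: A SODE on a Lie algebroid $\tau:E\to Q$ with anchor $\rho:E\to TQ$ is a smooth vector field $\Gamma$ on the manifold $E$ such that $(T_a\tau)(\Gamma(a))=\rho(a)$ for all $a\in E$. A morphism of Lie algebroids $\Psi:E_1\to E_2$ is a smooth vector bundle map, over a smooth map $\psi:Q_1\to Q_2$, that is compatible with the anchors ($\rho_2\circ\Psi=T\psi\circ\rho_1$) and with the brackets (equivalently, pull-back by $\Psi$ of sections of $\Lambda^\bullet E_2^*$ commutes with the Lie algebroid differentials). Fiberwise bijective means that $\Psi$ restricts to a linear isomorphism $(E_1)_q\to(E_2)_{\psi(q)}$ for every $q\in Q_1$. *)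

(* Defs.v *)
From HB Require Import structures.
From mathcomp Require Import all_boot all_order all_algebra.
From mathcomp Require Import all_classical all_reals all_analysis.

Set Implicit Arguments.
Unset Strict Implicit.
Unset Printing Implicit Defensive.
Import Order.TTheory GRing.Theory Num.Theory.
Import numFieldNormedType.Exports.
Local Open Scope classical_set_scope.
Local Open Scope ring_scope.

(** * Smooth maps between Euclidean spaces *)

(* Iterated partial derivatives up to order k exist and are continuous at every point
   of U. Only used for open U. *)
Fixpoint Ck_on (R : realType) (n : nat) (W : normedModType R) (k : nat)
    (U : set 'rV[R]_n) (f : 'rV[R]_n -> W) : Prop :=
  (forall x, U x -> {for x, continuous f}) /\
  match k with
  | 0 => True
  | k'.+1 => forall i : 'I_n,
      (forall x, U x -> derivable f x (delta_mx 0 i)) /\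
      Ck_on k' U ('D_(delta_mx 0 i) f)
  end.

Definition smooth_on (R : realType) (n : nat) (W : normedModType R)
    (U : set 'rV[R]_n) (f : 'rV[R]_n -> W) : Prop :=
  forall k, Ck_on k U f.

(** * Smooth manifolds *)

(* [cmap] is only meaningful on [cdom], [cinv] only on [cimg]. *)
Record chart (R : realType) (M : topologicalType) (n : nat) := Chart {
  cdom : set M;
  cimg : set 'rV[R]_n;
  cmap : M -> 'rV[R]_n;
  cinv : 'rV[R]_n -> M;
  cdom_open : open cdom;
  cimg_open : open cimg;
  cmap_img : forall p, cdom p -> cimg (cmap p);
  cinv_dom : forall x, cimg x -> cdom (cinv x);
  cmapK : forall p, cdom p -> cinv (cmap p) = p;
  cinvK : forall x, cimg x -> cmap (cinv x) = x;
  cmap_continuous : forall p, cdom p -> {for p, continuous cmap};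
  cinv_continuous : forall x, cimg x -> {for x, continuous cinv} }.

(* The smooth structure is given by any smooth atlas; everything defined below
   depends only on the maximal atlas it generates. *)
Record manifold (R : realType) := Manifold {
  mcarrier :> topologicalType;
  mdim : nat;
  mhausdorff : hausdorff_space mcarrier;
  msecond_countable : @second_countable mcarrier;
  mindex : Type;
  mchart : mindex -> chart R mcarrier mdim;
  mcover : forall p, exists i, cdom (mchart i) p;
  mcompat : forall i j,
    smooth_on (cimg (mchart i) `&` cinv (mchart i) @^-1` cdom (mchart j))
      (cmap (mchart j) \o cinv (mchart i)) }.

Section Manifolds.
Variable R : realType.
Implicit Types M N : manifold R.

(* Maps from an open subset W of a Euclidean space to a manifold. *)
Definition smooth_into n N (W : set 'rV[R]_n) (g : 'rV[R]_n -> N) : Prop :=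
  (forall x, W x -> {for x, continuous g}) /\
  forall j : mindex N,
    smooth_on (W `&` g @^-1` cdom (mchart j)) (cmap (mchart j) \o g).

Definition smooth_map M N (f : M -> N) : Prop :=
  forall i : mindex M, smooth_into (cimg (mchart i)) (f \o cinv (mchart i)).

(* Vector-valued functions, smooth on an open subset A of M. *)
Definition smooth_fun_on M (W : normedModType R) (A : set M) (f : M -> W) :
    Prop :=
  forall i : mindex M,
    smooth_on (cimg (mchart i) `&` cinv (mchart i) @^-1` A)
      (f \o cinv (mchart i)).

Definition smooth_fun M (f : M -> R) : Prop :=
  smooth_fun_on setT (f : M -> R^o).

(** ** Tangent vectors *)

Definition chart_at M (p : M) : chart R M (mdim M) :=
  mchart (projT1 (cid (mcover p))).

(* T_pM is R^n, a tangent vector being represented by its components in the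
   fixed chart [chart_at p]. The components in any other chart are obtained by
   the usual transformation rule, see [tangent_coord]. *)
Definition tangent M (p : M) : Type := 'rV[R]_(mdim M).

Definition tangent_coord M (i : mindex M) (p : M) (v : tangent p) :
    'rV[R]_(mdim M) :=
  'd (cmap (mchart i) \o cinv (chart_at p)) (cmap (chart_at p) p) v.

Definition tangent_map M N (f : M -> N) (p : M) (v : tangent p) :
    tangent (f p) :=
  'd (cmap (chart_at (f p)) \o f \o cinv (chart_at p)) (cmap (chart_at p) p) v.

(* The derivative v(f) of a real function. *)
Definition tangent_deriv M (p : M) (v : tangent p) (f : M -> R) : R :=
  'd ((f \o cinv (chart_at p)) : 'rV[R]_(mdim M) -> R^o)
    (cmap (chart_at p) p) v.

(* p |-> V p is smooth as a map M -> TN, read in the charts of TN induced by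
   those of N. The base map f is assumed smooth wherever this is used. *)
Definition smooth_along M N (f : M -> N) (V : forall p, tangent (f p)) : Prop :=
  forall (i : mindex M) (j : mindex N),
    smooth_on
      (cimg (mchart i) `&` (f \o cinv (mchart i)) @^-1` cdom (mchart j))
      (fun x => tangent_coord j (V (cinv (mchart i) x))).

Definition vector_field M (X : forall p : M, tangent p) : Prop :=
  smooth_along (f := idfun) X.

End Manifolds.

(** * Vector bundles *)

(* (vproj, phi) : vproj^-1(U) -> U x R^r is a diffeomorphism with inverse
   (q, y) |-> s q y, linear on each fibre. The pair (q, y) is a single row
   vector in the coordinates of each chart of Q. *)
Record local_trivialization (R : realType) (Q E : manifold R) (r : nat)
    (vproj : E -> Q) (vadd : E -> E -> E) (vscale : R -> E -> E)
    (U : set Q) (phi : E -> 'rV[R]_r) (s : Q -> 'rV[R]_r -> E) : Prop :=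
  LocalTrivialization {
  lt_open : open U;
  lt_smooth : smooth_fun_on (vproj @^-1` U) phi;
  lt_proj : forall q y, U q -> vproj (s q y) = q;
  lt_phiK : forall q y, U q -> phi (s q y) = y;
  lt_sK : forall a, U (vproj a) -> s (vproj a) (phi a) = a;
  lt_smooth_inv : forall i : mindex Q,
    smooth_into
      [set z : 'rV[R]_(mdim Q + r) | cimg (mchart i) (lsubmx z) /\
                                     U (cinv (mchart i) (lsubmx z))]
      (fun z => s (cinv (mchart i) (lsubmx z)) (rsubmx z));
  lt_add : forall a b, U (vproj a) -> vproj a = vproj b ->
    phi (vadd a b) = phi a + phi b;
  lt_scale : forall c a, U (vproj a) -> phi (vscale c a) = c *: phi a }.

(* [vadd a b] is only meaningful when a and b lie in the same fibre. The
   vector space axioms on the fibres follow from local triviality. *)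
Record vbundle (R : realType) := VBundle {
  vbase : manifold R;
  vtotal :> manifold R;
  vrank : nat;
  vproj : vtotal -> vbase;
  vadd : vtotal -> vtotal -> vtotal;
  vscale : R -> vtotal -> vtotal;
  proj_smooth : smooth_map vproj;
  proj_add : forall a b, vproj a = vproj b -> vproj (vadd a b) = vproj a;
  proj_scale : forall c a, vproj (vscale c a) = vproj a;
  locally_trivial : forall q, exists U (phi : vtotal -> 'rV[R]_vrank) s,
    U q /\ local_trivialization vproj vadd vscale U phi s }.

Section Sections.
Variables (R : realType) (E : vbundle R).

Definition is_section (X : vbase E -> E) : Prop :=
  smooth_map X /\ cancel X (@vproj R E).

Definition sadd (X Y : vbase E -> E) : vbase E -> E :=
  fun q => vadd (X q) (Y q).

Definition sscale (f : vbase E -> R) (X : vbase E -> E) : vbase E -> E :=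
  fun q => vscale (f q) (X q).

Definition in_fiber (q : vbase E) (s : seq E) : Prop :=
  {in s, forall a, vproj a = q}.

(* Sections of Lambda^k E^*. The value [w q s] is only meaningful when s has
   length k and all its entries lie in the fibre over q; q is kept as an
   argument so that the case k = 0 is that of functions on the base. *)
Record is_form (k : nat) (w : vbase E -> seq E -> R) : Prop := IsForm {
  form_add : forall q s t a b, size (s ++ a :: t) = k ->
    in_fiber q (a :: b :: s ++ t) ->
    w q (s ++ vadd a b :: t) = w q (s ++ a :: t) + w q (s ++ b :: t);
  form_scale : forall q s t c a, size (s ++ a :: t) = k ->
    in_fiber q (a :: s ++ t) ->
    w q (s ++ vscale c a :: t) = c * w q (s ++ a :: t);
  form_alt : forall q s t u a, size (s ++ a :: t ++ a :: u) = k ->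
    in_fiber q (s ++ a :: t ++ a :: u) ->
    w q (s ++ a :: t ++ a :: u) = 0;
  form_smooth : forall X : nat -> vbase E -> E,
    (forall l, is_section (X l)) ->
    smooth_fun (fun q => w q [seq X l q | l <- iota 0 k]) }.

End Sections.

(** * Lie algebroids *)

(* R-homogeneity of the bracket is [bracket_leibniz] for constant f; that the
   anchor preserves brackets follows from the other axioms. *)
Record lie_algebroid (R : realType) := LieAlgebroid {
  bundle :> vbundle R;
  anchor : forall a : bundle, tangent (vproj a);
  bracket : (vbase bundle -> bundle) -> (vbase bundle -> bundle) ->
            (vbase bundle -> bundle);
  anchor_smooth : smooth_along anchor;
  anchor_add : forall a b, vproj a = vproj b ->
    anchor (vadd a b) = anchor a + anchor b :> 'rV[R]_(mdim (vbase bundle));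
  anchor_scale : forall c a,
    anchor (vscale c a) = c *: anchor a :> 'rV[R]_(mdim (vbase bundle));
  bracket_section : forall X Y, is_section X -> is_section Y ->
    is_section (bracket X Y);
  bracket_add : forall X Y Z, is_section X -> is_section Y -> is_section Z ->
    bracket X (sadd Y Z) = sadd (bracket X Y) (bracket X Z);
  bracket_anticomm : forall X Y, is_section X -> is_section Y ->
    bracket X Y = sscale (fun=> -1) (bracket Y X);
  bracket_jacobi : forall X Y Z,
    is_section X -> is_section Y -> is_section Z ->
    bracket X (bracket Y Z) =
    sadd (bracket (bracket X Y) Z) (bracket Y (bracket X Z));
  bracket_leibniz : forall X Y f, is_section X -> is_section Y ->
    smooth_fun f ->
    bracket X (sscale f Y) =
    sadd (sscale f (bracket X Y))
         (sscale (fun q => tangent_deriv (anchor (X q)) f) Y) }.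

Section LieAlgebroids.
Variable R : realType.
Implicit Types A B : lie_algebroid R.

(* (d w)(X_0, ..., X_k)(q), for w a section of Lambda^k A^*. *)
Definition koszul A (k : nat) (w : vbase A -> seq A -> R)
    (X : nat -> vbase A -> A) (q : vbase A) : R :=
  (\sum_(i < k.+1) (-1) ^+ i *
    tangent_deriv (anchor (X i q))
      (fun q' => w q' [seq X l q' | l <- iota 0 k.+1 & l != i :> nat])) +
  (\sum_(i < k.+1) \sum_(j < k.+1 | (i < j)%N) (-1) ^+ (i + j)%N *
    w q (bracket (X i) (X j) q ::
         [seq X l q | l <- iota 0 k.+1 & (l != i :> nat) && (l != j :> nat)])).

(* h = d w *)
Definition is_differential A (k : nat) (w h : vbase A -> seq A -> R) : Prop :=
  forall X : nat -> vbase A -> A, (forall l, is_section (X l)) ->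
  forall q, h q [seq X l q | l <- iota 0 k.+1] = koszul k w X q.

Definition pullback A B (Psi : A -> B) (psi : vbase A -> vbase B)
    (w : vbase B -> seq B -> R) : vbase A -> seq A -> R :=
  fun q s => w (psi q) (map Psi s).

Record la_morphism A B (Psi : A -> B) (psi : vbase A -> vbase B) : Prop :=
  LAMorphism {
  mor_smooth : smooth_map Psi;
  mor_base_smooth : smooth_map psi;
  mor_proj : forall a, vproj (Psi a) = psi (vproj a);
  mor_add : forall a b, vproj a = vproj b ->
    Psi (vadd a b) = vadd (Psi a) (Psi b);
  mor_scale : forall c a, Psi (vscale c a) = vscale c (Psi a);
  mor_anchor : forall a,
    anchor (Psi a) = tangent_map psi (anchor a) :> 'rV[R]_(mdim (vbase B));
  mor_differential : forall k w h, is_form k w -> is_form k.+1 h ->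
    is_differential k w h ->
    is_differential k (pullback Psi psi w) (pullback Psi psi h) }.

(* The restrictions are linear by [mor_add] and [mor_scale]. *)
Definition fiberwise_bijective A B (Psi : A -> B) (psi : vbase A -> vbase B) :
    Prop :=
  forall q : vbase A,
    set_bij [set a : A | vproj a = q] [set b : B | vproj b = psi q] Psi.

Record sode A (Gamma : forall a : A, tangent a) : Prop := Sode {
  sode_vector_field : vector_field Gamma;
  sode_anchor : forall a, tangent_map (@vproj R A) (Gamma a) = anchor a }.

End LieAlgebroids.

(* Main.v *)
Require Import Defs.
From HB Require Import structures.
From mathcomp Require Import all_boot all_order all_algebra.
From mathcomp Require Import all_classical all_reals all_analysis.
From mathcomp Require Import ring.

(** A tangent vector u at a point a of E1 is determined by its projection
    T tau1 (u) and its image T Psi (u): in a local trivialization, Psi reads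
    (x, y) |-> (psi x, A(x) y) with A(x) invertible, so that with a fibre
    coordinate phi2 of E2 the map u |-> (T tau1 (u), d(phi2 o Psi)(u)) is a
    linear bijection.  Its inverse at (rho1 (a), d phi2 (Gamma2 (Psi a))) is the
    only possible value of Gamma1 at a, and it is mapped to Gamma2 (Psi a)
    because the morphism property rho2 o Psi = T psi o rho1 makes the base
    components agree.  The value is smooth in a because it solves a linear system
    u *m M = b with smooth coefficients and injective M, whence
    u = b *m M^T *m (M *m M^T)^-1. *)

Set Implicit Arguments.
Unset Strict Implicit.
Unset Printing Implicit Defensive.
Import Order.TTheory GRing.Theory Num.Theory.
Import numFieldNormedType.Exports.
Local Open Scope classical_set_scope.
Local Open Scope ring_scope.

(** * Functions of class C^k *)

Section CkGeneral.
Variables (R : realType) (n : nat) (W : normedModType R).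
Implicit Types (U V : set 'rV[R]_n) (f g : 'rV[R]_n -> W).

Lemma Ck_on_continuous k U f x : Ck_on k U f -> U x -> {for x, continuous f}.
Proof. by case: k => [|k] [cf _]; exact: cf. Qed.

Lemma Ck_on_sub k U V f : V `<=` U -> Ck_on k U f -> Ck_on k V f.
Proof.
move=> VU; elim: k f => [|k IH] f /= [cf df]; split => //.
- by move=> x /VU; exact: cf.
- by move=> x /VU; exact: cf.
- move=> i; have [di Di] := df i; split; last exact: IH.
  by move=> x /VU; exact: di.
Qed.

(** The conditions in [Ck_on] are imposed point by point, with continuity and derivatives taken in
    the ambient space whatever the set. A set V that merely contains x therefore carries all the
    information at x. *)
Lemma Ck_on_local k U f :
  (forall x, U x -> exists2 V, V x & Ck_on k V f) -> Ck_on k U f.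
Proof.
elim: k f => [|k IH] f loc /=.
  by split => // x /loc[V Vx [+ _]]; exact.
split=> [x /loc[V Vx [+ _]]|i]; first exact.
split=> [x /loc[V Vx [_ /(_ i)[+ _]]]|]; first exact.
by apply: IH => x /loc[V Vx [_ /(_ i)[_ DV]]]; exists V.
Qed.

Lemma Ck_onW k U f : Ck_on k.+1 U f -> Ck_on k U f.
Proof.
elim: k f => [|k IH] f [cf df]; first by split.
by split=> // i; have [di Di] := df i; split => //; exact: IH.
Qed.

Lemma eq_on_near U f g x : open U -> U x -> {in U, f =1 g} ->
  {near x, f =1 g}.
Proof.
move=> oU Ux fg; apply: filterS (open_nbhs_nbhs (conj oU Ux)) => y Uy.
by apply: fg; rewrite inE.
Qed.

(** Since U is open, f and g agree near each point of U, hence so do their derivatives of every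
    order. This is what allows a function to be replaced by a formula valid on U only. *)
Lemma eq_Ck_on k U f g : open U -> {in U, f =1 g} ->
  Ck_on k U f -> Ck_on k U g.
Proof.
move=> oU; elim: k f g => [|k IH] f g fg [cf df]; split => //.
- move=> x Ux; rewrite /prop_for /continuous_at -(fg x) ?inE//.
  exact: (cvg_trans (near_eq_cvg (eq_on_near oU Ux fg)) (cf x Ux)).
- move=> x Ux; rewrite /prop_for /continuous_at -(fg x) ?inE//.
  exact: (cvg_trans (near_eq_cvg (eq_on_near oU Ux fg)) (cf x Ux)).
- move=> i; have [di Di] := df i; split.
    by move=> x Ux; exact: (near_eq_derivable (eq_on_near oU Ux fg) (di x Ux)).
  apply: IH Di => x; rewrite inE => Ux; apply: near_eq_derive.
  exact: (eq_on_near oU Ux fg).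
Qed.

Lemma Ck_on_cst k U (c : W) : Ck_on k U (cst c).
Proof.
elim: k c => [|k IH] c; (split; first by move=> x _; exact: cst_continuous) => //.
move=> i; split=> [x _|]; first exact: derivable_cst.
rewrite (_ : 'D_ _ _ = cst 0)//; apply/funext => x; exact: derive_cst.
Qed.

Lemma Ck_onD k U f g : open U ->
  Ck_on k U f -> Ck_on k U g -> Ck_on k U (f \+ g).
Proof.
move=> oU; elim: k f g => [|k IH] f g [cf df] [cg dg]; split => //.
- by move=> x Ux; apply: continuousD; [exact: cf|exact: cg].
- by move=> x Ux; apply: continuousD; [exact: cf|exact: cg].
- move=> i; have [di Di] := df i; have [ei Ei] := dg i.
  split=> [x Ux|]; first by apply: derivableD; [exact: di|exact: ei].
  apply: (eq_Ck_on oU _ (IH _ _ Di Ei)) => x; rewrite inE => Ux /=.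
  by rewrite -deriveD; [|exact: di|exact: ei].
Qed.

Lemma Ck_on_sum (I : Type) (s : seq I) (P : pred I) k U (F : I -> 'rV[R]_n -> W) :
  open U -> (forall i, P i -> Ck_on k U (F i)) ->
  Ck_on k U (fun x => \sum_(i <- s | P i) F i x).
Proof.
move=> oU CF; elim: s => [|i s IH].
  apply: (eq_Ck_on oU _ (@Ck_on_cst k U 0)) => x _.
  by rewrite big_nil.
have [Pi|nPi] := boolP (P i).
  apply: (eq_Ck_on oU _ (Ck_onD oU (CF _ Pi) IH)) => x _.
  by rewrite big_cons Pi.
by apply: (eq_Ck_on oU _ IH) => x _; rewrite big_cons (negPf nPi).
Qed.

End CkGeneral.

Section CkReal.
Variables (R : realType) (n : nat).
Implicit Types (U V : set 'rV[R]_n) (f g : 'rV[R]_n -> R^o).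

Lemma Ck_onM k U f g : open U ->
  Ck_on k U f -> Ck_on k U g -> Ck_on k U (fun x => (f x * g x) : R^o).
Proof.
have cM f' g' l x : Ck_on l U f' -> Ck_on l U g' -> U x ->
    {for x, continuous (fun x => (f' x * g' x) : R^o)}.
  by move=> Cf Cg Ux; apply: continuousM;
    [exact: Ck_on_continuous Cf Ux|exact: Ck_on_continuous Cg Ux].
move=> oU; elim: k f g => [|k IH] f g Cf Cg.
  by split=> // x; exact: (cM _ _ _ _ Cf Cg).
split=> [x|i]; first exact: (cM _ _ _ _ Cf Cg).
have [di Di] := Cf.2 i; have [ei Ei] := Cg.2 i.
split=> [x Ux|]; first by apply: derivableM; [exact: di|exact: ei].
(* Leibniz rule: each term pairs an undifferentiated factor, lowered by one order, with a partial
   derivative of the other. *)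
have := Ck_onD oU (IH _ _ (Ck_onW Cf) Ei) (IH _ _ (Ck_onW Cg) Di).
apply: eq_Ck_on => // x; rewrite inE => Ux /=.
by rewrite deriveM //; [exact: di|exact: ei].
Qed.

(** The partial derivatives are - f^-1 f^-1 Df, in which f^-1 is already of class C^k by induction
    when f is of class C^(k+1). *)
Lemma Ck_onV k U f : open U -> (forall x, U x -> f x != 0) ->
  Ck_on k U f -> Ck_on k U (fun x => (f x)^-1 : R^o).
Proof.
move=> oU f0.
have cV l x : Ck_on l U f -> U x -> {for x, continuous (fun x => (f x)^-1 : R^o)}.
  by move=> Cf Ux; apply: continuousV; [exact: f0|exact: Ck_on_continuous Cf Ux].
elim: k => [|k IH] Cf; first by split=> // x; exact: (cV _ _ Cf).
split=> [x|i]; first exact: (cV _ _ Cf).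
have [di Di] := Cf.2 i.
split=> [x Ux|]; first by apply: derivableV; [exact: f0|exact: di].
have CV := IH (Ck_onW Cf).
have := Ck_onM oU (@Ck_on_cst R n R^o k U (-1)) (Ck_onM oU (Ck_onM oU CV CV) Di).
apply: eq_Ck_on => // x; rewrite inE => Ux /=.
rewrite deriveV; [|exact: f0|exact: di].
by rewrite mulN1r scaleNr expr2 invfM.
Qed.

Lemma Ck_on_prod (I : Type) (s : seq I) (P : pred I) k U
    (F : I -> 'rV[R]_n -> R^o) :
  open U -> (forall i, P i -> Ck_on k U (F i)) ->
  Ck_on k U (fun x => \prod_(i <- s | P i) F i x : R^o).
Proof.
move=> oU CF; elim: s => [|i s IH].
  apply: (eq_Ck_on oU _ (@Ck_on_cst _ _ R^o k U 1)) => x _.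
  by rewrite big_nil.
have [Pi|nPi] := boolP (P i).
  apply: (eq_Ck_on oU _ (Ck_onM oU (CF _ Pi) IH)) => x _.
  by rewrite big_cons Pi.
by apply: (eq_Ck_on oU _ IH) => x _; rewrite big_cons (negPf nPi).
Qed.

(** Matrix neighbourhoods are generated by families of neighbourhoods of the entries, and finitely
    many entrywise conditions hold simultaneously near x. *)
Lemma continuous_mxP (T : topologicalType) m p (f : T -> 'M[R]_(m, p)) x :
  {for x, continuous f} <->
  forall i j, {for x, continuous (fun y => f y i j : R^o)}.
Proof.
split=> [cf i j|cf].
  exact: (continuous_comp cf (@coord_continuous R m p i j (f x))).
move=> A [P Pf PA]; rewrite nbhs_simpl /=.
have : \forall y \near x, forall i j, P i j (f y i j).
  apply: filter_forall => i; apply: filter_forall => j.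
  exact: (cf i j _ (Pf i j)).
by apply: filterS => y Py; exact: PA.
Qed.

Lemma Ck_on_mxP m p k U (f : 'rV[R]_n -> 'M[R]_(m, p)) : open U ->
  Ck_on k U f <-> forall i j, Ck_on k U (fun x => f x i j : R^o).
Proof.
move=> oU; elim: k f => [|k IH] f; split=> [Cf i j|Cf].
- by split=> // x Ux; exact: ((continuous_mxP _ _).1 (Cf.1 x Ux)).
- by split=> // x Ux; apply/continuous_mxP => i j; exact: (Cf i j).1.
- split=> [x Ux|l]; first exact: ((continuous_mxP _ _).1 (Cf.1 x Ux)).
  have [dl Dl] := Cf.2 l; split=> [x Ux|].
    exact: ((derivable_mxP _ _ _).1 (dl x Ux)).
  apply: (eq_Ck_on oU _ ((IH _).1 Dl i j)) => x; rewrite inE => Ux.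
  by rewrite derive_mx ?mxE//; exact: dl.
- split=> [x Ux|l]; first by apply/continuous_mxP => i j; exact: (Cf i j).1.
  have dl x : U x -> derivable f x (delta_mx 0 l).
    by move=> Ux; apply/derivable_mxP => i j; exact: ((Cf i j).2 l).1.
  split=> //; apply/IH => i j.
  apply: (eq_Ck_on oU _ ((Cf i j).2 l).2) => x; rewrite inE => Ux.
  by rewrite derive_mx ?mxE//; exact: dl.
Qed.

End CkReal.

(** * Differentiability of C^1 functions *)

(** Mean value inequality between 0 and b. The sign of b is arbitrary, hence the symmetric interval
    in the assumption. *)
Lemma MVT_le (R : realType) (g dg : R -> R) (b e : R) :
  (forall t : R, `|t| <= `|b| -> is_derive t 1 g (dg t) /\ `|dg t| <= e) ->
  `|g b - g 0| <= e * `|b|.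
Proof.
move=> gP.
have cg c d : (forall t, t \in `[c, d]%R -> `|t| <= `|b|) ->
    {within `[c, d], continuous g}.
  move=> cd; apply: derivable_within_continuous => t /cd/gP[[]].
  by move=> + _ _.
have [b0|b0] := leP 0 b.
  have ub t : t \in `[0, b]%R -> `|t| <= `|b|.
    by rewrite in_itv/= => /andP[t0 tb]; rewrite !ger0_norm.
  have [t tb|c cb ->] := @MVT_segment _ g dg _ _ b0 _ (cg _ _ ub).
    by have [] := gP t (ub t (subset_itv_oo_cc tb)).
  by rewrite subr0 normrM ler_wpM2r//; have [_] := gP c (ub c cb).
have ub t : t \in `[b, 0]%R -> `|t| <= `|b|.
  by rewrite in_itv/= => /andP[t0 tb]; rewrite !ler0_norm ?lerN2// ltW.
have [t tb|c cb] := @MVT_segment _ g dg _ _ (ltW b0) _ (cg _ _ ub).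
  by have [] := gP t (ub t (subset_itv_oo_cc tb)).
rewrite distrC => ->.
by rewrite sub0r normrM normrN ler_wpM2r//; have [_] := gP c (ub c cb).
Qed.

Section C1Differentiable.
Variables (R : realType) (n : nat).

Lemma mx_coord_norm m p (x : 'M[R]_(m, p)) i j : `|x i j| <= `|x|.
Proof.
by rewrite [leRHS]/Num.Def.normr/= mx_normrE; exact: (le_bigmax _ _ (i, j)).
Qed.

Lemma mx_norm_leP m p (x : 'M[R]_(m, p)) (e : R) : 0 <= e ->
  (forall i j, `|x i j| <= e) -> `|x| <= e.
Proof.
move=> e0 xe; rewrite [leLHS]/Num.Def.normr/= mx_normrE.
by apply: bigmax_le => // -[i j] _; exact: xe.
Qed.

(** The two difference quotients are the same function of h, because h v + (t v + y) = (h + t) v +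
    y. *)
Lemma is_derive_line (f : 'rV[R]_n -> R^o) (y v : 'rV[R]_n) (t : R) :
  derivable f (t *: v + y) v ->
  is_derive t 1 (fun s : R => f (s *: v + y)) ('D_v f (t *: v + y)).
Proof.
set z := t *: v + y; pose g (s : R) := f (s *: v + y).
have E : (fun h : R => h^-1 *: ((f \o shift z) (h *: v) - f z)) =
    (fun h : R => h^-1 *: ((g \o shift t) (h *: 1) - f z)).
  by apply/funext => h; rewrite /g /z /= addrA -scalerDl [h *: 1]mulr1.
move=> df; split; first by move: df; rewrite /derivable E.
by rewrite /derive E.
Qed.

(** These are the vertices of the path from 0 to h that moves along one coordinate axis at a
    time. *)
Definition row_trunc (k : nat) (h : 'rV[R]_n) : 'rV[R]_n :=
  \row_i (if (i < k)%N then h 0 i else 0).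

Lemma row_truncS (k : 'I_n) (h : 'rV[R]_n) :
  row_trunc k.+1 h = h 0 k *: delta_mx 0 k + row_trunc k h.
Proof.
apply/rowP => i; rewrite !mxE eqxx ltnS leq_eqVlt /=.
have [->|ik] := eqVneq i k; first by rewrite eqxx ltnn mulr1 addr0.
by rewrite (negPf (_ : val i != val k)) ?mulr0 ?add0r.
Qed.

(** For the sup norm, no edge of the coordinate path leaves the ball of radius |h|, so bounds on the
    partial derivatives in that ball apply along the whole path. *)
Lemma row_trunc_norm (k : 'I_n) (h : 'rV[R]_n) t : `|t| <= `|h 0 k| ->
  `|t *: delta_mx 0 k + row_trunc k h| <= `|h|.
Proof.
move=> th; apply: mx_norm_leP => // i j; rewrite !mxE ord1 eqxx /=.
have [->|jk] := eqVneq j k.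
  by rewrite ltnn mulr1 addr0 (le_trans th)// mx_coord_norm.
rewrite mulr0 add0r; case: ifP => _; first exact: mx_coord_norm.
by rewrite normr0.
Qed.

(** Telescoping along the coordinate path: each of the n edges contributes an error of at most e |h|
    by the mean value inequality. *)
Lemma partials_increment (f : 'rV[R]_n -> R^o) (a h : 'rV[R]_n) (e d : R) :
  0 <= e ->
  (forall y, `|y - a| < d -> forall i : 'I_n, derivable f y (delta_mx 0 i) /\
     `|'D_(delta_mx 0 i) f y - 'D_(delta_mx 0 i) f a| <= e) ->
  `|h| < d ->
  `|f (h + a) - f a - \sum_(i < n) h 0 i * 'D_(delta_mx 0 i) f a|
    <= n%:R * e * `|h|.
Proof.
move=> e0 fP hd.
have main k : (k <= n)%N ->
  `|f (row_trunc k h + a) - f a -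
    \sum_(i < n | (i < k)%N) h 0 i * 'D_(delta_mx 0 i) f a| <= k%:R * e * `|h|.
  elim: k => [|k IH] kn.
    rewrite (_ : row_trunc 0 h = 0) ?add0r; last by apply/rowP => i; rewrite !mxE.
    by rewrite big_pred0_eq subrr subr0 normr0 !mul0r.
  pose k' := Ordinal kn; pose v : 'rV[R]_n := delta_mx 0 k'.
  rewrite (row_truncS k' h) -/v -(addrA _ _ a).
  rewrite (bigD1 k')//= (eq_bigl (fun i : 'I_n => (i < k)%N)); last first.
    by move=> i; rewrite ltnS (leq_eqVlt i) -(inj_eq val_inj) /=; case: ltngtP.
  set y := row_trunc k h + a.
  (* Subtracting the slope at a leaves a function whose derivative is a difference of partial
     derivatives, bounded by e. *)
  pose g (t : R) : R := f (t *: v + y) - t * 'D_v f a.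
  have ge : `|g (h 0 k') - g 0| <= e * `|h 0 k'|.
    apply: (@MVT_le R g (fun t => 'D_v f (t *: v + y) - 'D_v f a)) => t th.
    have /fP/(_ k')[df dfe] : `|t *: v + y - a| < d.
      by rewrite /y addrA addrK (le_lt_trans _ hd)// row_trunc_norm.
    split => //; apply: is_deriveB; first exact: is_derive_line.
    apply: is_derive_eq => /=.
    by rewrite scaler0 add0r [_ *: 1]mulr1.
  rewrite /g !scale0r add0r mul0r subr0 in ge.
  rewrite -natr1 mulrDl mul1r mulrDl.
  have := IH (ltnW kn).
  set S := \sum_(_ | _) _; rewrite -/y => IHk.
  rewrite (_ : _ - _ - _ = (f y - f a - S) +
     (f (h 0 k' *: v + y) - h 0 k' * 'D_v f a - f y)); last first.
    by ring.
  rewrite (le_trans (ler_normD _ _))// lerD// (le_trans ge)//.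
  by rewrite ler_wpM2l// mx_coord_norm.
have := main n (leqnn n).
rewrite (_ : row_trunc n h = h); last by apply/rowP => i; rewrite mxE ltn_ord.
by under eq_bigl do rewrite ltn_ord.
Qed.

End C1Differentiable.

(** The estimate is the expansion f (x + h) = f x + df h + o(h), and uniqueness of the linear term
    identifies the differential. *)
Lemma differentiable_of_increment (R : realType) (V W : normedModType R)
    (f : V -> W) (df : {linear V -> W}) (x : V) : continuous df ->
  (forall e : R, 0 < e ->
    \forall h \near (0 : V), `|f (h + x) - (f x + df h)| <= e * `|h|) ->
  differentiable f x /\ 'd f x = df :> (V -> W).
Proof.
move=> cdf incr.
have o : f \o shift x = cst (f x) + df +o_ 0 id by apply/eqaddoP.
have E := diff_unique cdf o.
by split=> //; apply/diff_locallyP; rewrite E.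
Qed.

Section Differentiable.
Variables (R : realType) (n : nat).
Implicit Types (U V : set 'rV[R]_n).

(** Continuity of the partial derivatives at a makes their oscillation small on a ball, where
    [partials_increment] bounds the remainder of the linear candidate [L]. *)
Lemma Ck_on_differentiable_real k U (f : 'rV[R]_n -> R^o) a :
  open U -> Ck_on k.+1 U f -> U a -> differentiable f a.
Proof.
move=> oU [cf df] Ua.
pose L (h : 'rV[R]_n) : R^o := \sum_(i < n) h 0 i * 'D_(delta_mx 0 i) f a.
have Llin : linear L.
  move=> c u v; rewrite /L scaler_sumr -big_split /=.
  by apply: eq_bigr => i _; rewrite !mxE mulrDl scalerAl.
pose LM := GRing.isLinear.Build _ _ _ _ _ Llin.
pose dL : {linear 'rV[R]_n -> R^o} := HB.pack L LM.
have cL : continuous dL.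
  move=> x; change {for x, continuous L}.
  apply: (@Ck_on_continuous _ _ _ 0%N setT) => //.
  apply: Ck_on_sum; first exact: openT.
  move=> i _; apply: Ck_onM; [exact: openT| |exact: Ck_on_cst].
  by split => // y _; exact: coord_continuous.
suff incr e : 0 < e ->
    \forall h \near (0 : 'rV[R]_n), `|f (h + a) - (f a + dL h)| <= e * `|h|.
  by have [] := differentiable_of_increment cL incr.
move=> /posnumP[{}e].
(* The increment bound loses a factor n; dividing by n + 1 absorbs it and remains meaningful when n
   = 0. *)
pose e' : R := e%:num / n.+1%:R.
have e'0 : 0 < e' by rewrite divr_gt0.
have /nbhs_ballP[d /= d0 dP] : \forall y \near a, U y /\
   forall i : 'I_n, `|'D_(delta_mx 0 i) f y - 'D_(delta_mx 0 i) f a| <= e'.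
  have H : \forall y \near a, forall i : 'I_n,
      `|'D_(delta_mx 0 i) f y - 'D_(delta_mx 0 i) f a| <= e'.
    pose P (i : 'I_n) (y : 'rV[R]_n) : Prop :=
      `|'D_(delta_mx 0 i) f y - 'D_(delta_mx 0 i) f a| <= e'.
    have HP (i : 'I_n) : nbhs a (P i).
      have := Ck_on_continuous (df i).2 Ua.
      move/cvgrPdist_le => /(_ _ e'0); apply: filterS => y.
      by rewrite /P distrC.
    exact: (filter_forall (nbhs_filter a) HP).
  exact: (filterI (open_nbhs_nbhs (conj oU Ua)) H).
near=> h.
have hd : `|h| < d.
  by near: h; exact: (@nbhs0_lt R 'rV[R]_n _ d0).
have fP y : `|y - a| < d -> forall i : 'I_n, derivable f y (delta_mx 0 i) /\
   `|'D_(delta_mx 0 i) f y - 'D_(delta_mx 0 i) f a| <= e'.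
  move=> ya i; have [Uy /(_ i) De] : U y /\
     forall i : 'I_n, `|'D_(delta_mx 0 i) f y - 'D_(delta_mx 0 i) f a| <= e'.
    by apply: dP; rewrite -ball_normE /= distrC.
  by split => //; exact: (df i).1.
have := partials_increment (ltW e'0) fP hd.
rewrite opprD addrA => /le_trans; apply.
by rewrite ler_wpM2r// /e' mulrCA ler_piMr// ler_pdivrMr// mul1r ler_nat.
Unshelve. all: by end_near. Qed.

Lemma differentiable_mx (p : nat) (f : 'rV[R]_n -> 'rV[R]_p) a :
  (forall j, differentiable (fun x => f x 0 j : R^o) a) -> differentiable f a.
Proof.
move=> df.
have -> : f = \sum_(j < p) (fun x => f x 0 j *: delta_mx 0 j).
  apply/funext => x; rewrite fct_sumE; apply/rowP => j.
  rewrite summxE (bigD1 j)//= big1 ?addr0 => [|i ij]; rewrite !mxE !eqxx ?mulr1//=.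
  by rewrite [j == i]eq_sym (negPf ij) mulr0.
by apply: differentiable_sum => j; apply: differentiableZl.
Qed.

Lemma Ck_on_differentiable k U p (f : 'rV[R]_n -> 'rV[R]_p) a :
  open U -> Ck_on k.+1 U f -> U a -> differentiable f a.
Proof.
move=> oU Cf Ua; apply: differentiable_mx => j.
exact: (Ck_on_differentiable_real oU ((Ck_on_mxP _ _ oU).1 Cf 0 j) Ua).
Qed.

Lemma diff_partials (W : normedModType R) (f : 'rV[R]_n -> W) a v :
  differentiable f a ->
  'd f a v = \sum_(i < n) v 0 i *: 'D_(delta_mx 0 i) f a.
Proof.
move=> df; rewrite {1}(row_sum_delta v) linear_sum.
by apply: eq_bigr => i _; rewrite linearZ/= deriveE.
Qed.

(** Near 0 the remainder of f at a is also the remainder of g with the same linear map; the value at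
    a itself agrees because a lies in each of its neighbourhoods. *)
Lemma near_eq_differentiable (W : normedModType R) (f g : 'rV[R]_n -> W) a :
  {near a, f =1 g} -> differentiable f a ->
  differentiable g a /\ 'd g a = 'd f a :> ('rV[R]_n -> W).
Proof.
move=> fg df.
apply: (differentiable_of_increment (diff_continuous df)) => e e0.
have := diff_locally df => /eqaddoP/(_ e e0).
have : \forall h \near (0 : 'rV[R]_n), f (h + a) = g (h + a).
  by move: fg; rewrite (near_shift 0) subr0 /=; apply: filterS => h /=.
apply: filterS2 => h fgh.
by rewrite -[X in `|X|]/(f (h + a) - (f a + 'd f a h)) fgh (nbhs_singleton fg).
Qed.

End Differentiable.

(** * Composition of maps of class C^k *)

Section Composition.
Variables (R : realType) (n m : nat).

(** Induction on the order by the chain rule: D_i (g o f) is the sum over j of D_i f_j times (D_j g)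
    o f, and the induction hypothesis applies to D_j g. *)
Lemma Ck_on_comp_real k (U : set 'rV[R]_n) (V : set 'rV[R]_m)
    (g : 'rV[R]_m -> R^o) (f : 'rV[R]_n -> 'rV[R]_m) :
  open U -> open V -> (forall x, U x -> V (f x)) ->
  Ck_on k V g -> Ck_on k U f -> Ck_on k U (g \o f).
Proof.
move=> oU oV UV; elim: k g => [|k IH] g Cg Cf.
  split=> // x Ux; apply: continuous_comp; first exact: Ck_on_continuous Cf Ux.
  exact: Ck_on_continuous Cg (UV _ Ux).
have df x : U x -> differentiable f x by exact: Ck_on_differentiable Cf.
have dg x : U x -> differentiable g (f x).
  by move=> /UV; exact: Ck_on_differentiable_real Cg.
split=> [x Ux|i].
  by apply/differentiable_continuous/differentiable_comp; [exact: df|exact: dg].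
split=> [x Ux|].
  by apply: diff_derivable; apply: differentiable_comp; [exact: df|exact: dg].
apply: (@eq_Ck_on _ _ _ _ _ (fun x => \sum_(j < m)
   ('D_(delta_mx 0 i) f x 0 j * ('D_(delta_mx 0 j) g \o f) x) : R^o)) => //.
  move=> x; rewrite inE => Ux.
  have dgf : differentiable (g \o f) x.
    by apply: differentiable_comp; [exact: df|exact: dg].
  rewrite [RHS]deriveE// diff_comp//=; [|exact: df|exact: dg].
  by rewrite diff_partials ?deriveE//; [exact: df|exact: dg].
apply: Ck_on_sum => // j _; apply: Ck_onM => //.
  by apply: (Ck_on_mxP _ _ oU).1; exact: (Cf.2 i).2.
by apply: IH; [exact: (Cg.2 j).2|exact: Ck_onW].
Qed.

Lemma Ck_on_comp p k (U : set 'rV[R]_n) (V : set 'rV[R]_m)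
    (g : 'rV[R]_m -> 'rV[R]_p) (f : 'rV[R]_n -> 'rV[R]_m) :
  open U -> open V -> (forall x, U x -> V (f x)) ->
  Ck_on k V g -> Ck_on k U f -> Ck_on k U (g \o f).
Proof.
move=> oU oV UV Cg Cf; apply/Ck_on_mxP => // i j.
exact: (Ck_on_comp_real oU oV UV ((Ck_on_mxP _ _ oV).1 Cg i j) Cf).
Qed.

End Composition.

(** * Smooth matrix functions and linear systems *)

Section LeftInverse.
Variables (R : realFieldType) (p q : nat).

Lemma mulmx_tr_eq0 (y : 'rV[R]_q) : y *m y^T = 0 -> y = 0.
Proof.
move/matrixP => /(_ 0 0); rewrite !mxE.
under eq_bigr do rewrite mxE -expr2.
move/eqP; rewrite psumr_eq0 => [/allP y0|j _]; last exact: sqr_ge0.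
apply/rowP => j; rewrite mxE; apply/eqP; rewrite -sqrf_eq0.
exact: y0 (mem_index_enum j).
Qed.

(** If u M M^T = 0, then (u M)(u M)^T = 0, a vanishing sum of squares, so u M = 0. *)
Lemma gram_unitmx (M : 'M[R]_(p, q)) :
  (forall u : 'rV[R]_p, u *m M = 0 -> u = 0) -> M *m M^T \in unitmx.
Proof.
move=> inj; rewrite -row_free_unit -kermx_eq0; apply/rowV0P => u /sub_kermxP uMM.
apply: inj; apply: mulmx_tr_eq0.
by rewrite trmx_mul mulmxA -(mulmxA u) uMM mul0mx.
Qed.

Lemma gram_solve (M : 'M[R]_(p, q)) (u : 'rV[R]_p) :
  (forall u : 'rV[R]_p, u *m M = 0 -> u = 0) ->
  u *m M *m M^T *m invmx (M *m M^T) = u.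
Proof. by move=> /gram_unitmx MM; rewrite -(mulmxA u) mulmxK. Qed.

End LeftInverse.

Section Smooth.
Variables (R : realType) (n : nat).
Implicit Types (U V : set 'rV[R]_n).

Lemma eq_smooth_on (W : normedModType R) U (f g : 'rV[R]_n -> W) :
  open U -> {in U, f =1 g} -> smooth_on U f -> smooth_on U g.
Proof. by move=> oU fg Sf k; exact: (eq_Ck_on oU fg). Qed.

Lemma smooth_on_sub (W : normedModType R) U V (f : 'rV[R]_n -> W) :
  V `<=` U -> smooth_on U f -> smooth_on V f.
Proof. by move=> VU Sf k; exact: (Ck_on_sub VU). Qed.

Lemma smooth_on_local (W : normedModType R) U (f : 'rV[R]_n -> W) :
  (forall x, U x -> exists2 V, V x & smooth_on V f) -> smooth_on U f.
Proof.
by move=> loc k; apply: Ck_on_local => x /loc[V Vx Sf]; exists V.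
Qed.

Lemma smooth_on_differentiable U p (f : 'rV[R]_n -> 'rV[R]_p) a :
  open U -> smooth_on U f -> U a -> differentiable f a.
Proof. by move=> oU /(_ 1%N); exact: Ck_on_differentiable. Qed.

Lemma smooth_on_mxP m p U (f : 'rV[R]_n -> 'M[R]_(m, p)) : open U ->
  smooth_on U f <-> forall i j, smooth_on U (fun x => f x i j : R^o).
Proof.
move=> oU; split=> [Sf i j k|Sf k].
  exact: ((Ck_on_mxP _ _ oU).1 (Sf k)).
by apply/Ck_on_mxP => // i j; exact: Sf.
Qed.

Lemma smooth_on_comp m p (U : set 'rV[R]_n) (V : set 'rV[R]_m)
    (g : 'rV[R]_m -> 'rV[R]_p) (f : 'rV[R]_n -> 'rV[R]_m) :
  open U -> open V -> (forall x, U x -> V (f x)) ->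
  smooth_on V g -> smooth_on U f -> smooth_on U (g \o f).
Proof. by move=> oU oV UV Sg Sf k; exact: (Ck_on_comp oU oV UV). Qed.

Lemma smooth_onM U (f g : 'rV[R]_n -> R^o) : open U ->
  smooth_on U f -> smooth_on U g -> smooth_on U (fun x => (f x * g x) : R^o).
Proof. by move=> oU Sf Sg k; exact: Ck_onM. Qed.

Lemma smooth_on_sum (W : normedModType R) (I : Type) (s : seq I) (P : pred I) U
    (F : I -> 'rV[R]_n -> W) :
  open U -> (forall i, P i -> smooth_on U (F i)) ->
  smooth_on U (fun x => \sum_(i <- s | P i) F i x).
Proof. by move=> oU SF k; apply: Ck_on_sum => // i Pi; exact: SF. Qed.

Lemma smooth_on_mul m p q U (A : 'rV[R]_n -> 'M[R]_(m, p))
    (B : 'rV[R]_n -> 'M[R]_(p, q)) : open U ->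
  smooth_on U A -> smooth_on U B -> smooth_on U (fun x => A x *m B x).
Proof.
move=> oU /(smooth_on_mxP _ oU) SA /(smooth_on_mxP _ oU) SB.
apply/smooth_on_mxP => // i j; under eq_fun do rewrite mxE.
by apply: smooth_on_sum => // l _; exact: smooth_onM.
Qed.

Lemma smooth_on_tr m p U (A : 'rV[R]_n -> 'M[R]_(m, p)) : open U ->
  smooth_on U A -> smooth_on U (fun x => (A x)^T).
Proof.
move=> oU /(smooth_on_mxP _ oU) SA.
apply/smooth_on_mxP => // i j; under eq_fun do rewrite mxE.
exact: SA.
Qed.

Lemma smooth_on_det p U (A : 'rV[R]_n -> 'M[R]_p) : open U ->
  smooth_on U A -> smooth_on U (fun x => \det (A x) : R^o).
Proof.
move=> oU /(smooth_on_mxP _ oU) SA.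
rewrite /determinant; apply: smooth_on_sum => // s _; apply: smooth_onM => //.
  by move=> k; exact: Ck_on_cst.
by move=> k; apply: Ck_on_prod => // i _; exact: SA.
Qed.

(** Cramer's rule: the entries of the inverse are signed minors divided by the determinant. *)
Lemma smooth_on_inv p U (A : 'rV[R]_n -> 'M[R]_p) : open U ->
  (forall x, U x -> A x \in unitmx) ->
  smooth_on U A -> smooth_on U (fun x => invmx (A x)).
Proof.
move=> oU uA SA.
apply: (@eq_smooth_on _ _ (fun x => (\det (A x))^-1 *: \adj (A x))) => //.
  by move=> x; rewrite inE => /uA Ax; rewrite /invmx Ax.
apply/smooth_on_mxP => // i j; under eq_fun do rewrite !mxE.
apply: smooth_onM => //.
  move=> k; apply: Ck_onV => //; last exact: smooth_on_det.
  by move=> x /uA; rewrite unitmxE unitfE.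
apply: smooth_onM => //; first by move=> k; exact: Ck_on_cst.
apply: smooth_on_det => //; apply/smooth_on_mxP => // i' j'.
under eq_fun do rewrite !mxE.
by move/(smooth_on_mxP _ oU): SA => SA; exact: SA.
Qed.

Lemma smooth_on_coord U j : open U -> smooth_on U (fun x => x 0 j : R^o).
Proof.
move=> oU; case=> [|k]; first by split => // x _; exact: coord_continuous.
split=> [x _|i]; first exact: coord_continuous.
have dj (x : 'rV[R]_n) : differentiable (fun x : 'rV[R]_n => x 0 j : R^o) x.
  exact: differentiable_coord.
split=> [x _|]; first exact: diff_derivable.
rewrite (_ : 'D_ _ _ = cst ((delta_mx 0 i : 'rV[R]_n) 0 j : R^o)).
  exact: Ck_on_cst.
apply/funext => x /=.
have did : derivable (id : 'rV[R]_n -> 'rV[R]_n) x (delta_mx 0 i).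
  exact: derivable_id.
have E := congr1 (fun A : 'rV[R]_n => A 0 j) (derive_mx did).
by rewrite [LHS]/= derive_id [RHS]mxE in E; exact: (esym E).
Qed.

Lemma smooth_on_id U : open U -> smooth_on U (id : 'rV[R]_n -> 'rV[R]_n).
Proof.
move=> oU; apply/smooth_on_mxP => // i j; rewrite ord1.
exact: smooth_on_coord.
Qed.

Lemma smooth_on_row_mx p q U
    (f : 'rV[R]_n -> 'rV[R]_p) (g : 'rV[R]_n -> 'rV[R]_q) :
  open U -> smooth_on U f -> smooth_on U g ->
  smooth_on U (fun x => row_mx (f x) (g x)).
Proof.
move=> oU /(smooth_on_mxP _ oU) Sf /(smooth_on_mxP _ oU) Sg.
apply/smooth_on_mxP => // i j; under eq_fun do rewrite mxE.
by case: (fintype.split j) => l; [exact: Sf|exact: Sg].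
Qed.

(** Nothing is assumed about the regularity of u: the Gram formula expresses it through M and b. The
    formula makes sense for rectangular M; in the application p is the dimension of [E1], and q that
    of its base plus the rank of [E2]. *)
Lemma smooth_on_solve p q U (M : 'rV[R]_n -> 'M[R]_(p, q))
    (b : 'rV[R]_n -> 'rV[R]_q) (u : 'rV[R]_n -> 'rV[R]_p) : open U ->
  smooth_on U M -> smooth_on U b ->
  (forall x, U x -> forall v : 'rV[R]_p, v *m M x = 0 -> v = 0) ->
  (forall x, U x -> u x *m M x = b x) -> smooth_on U u.
Proof.
move=> oU SM Sb inj uM.
apply: (@eq_smooth_on _ _
  (fun x => b x *m (M x)^T *m invmx (M x *m (M x)^T))) => //.
  by move=> x; rewrite inE => Ux; rewrite -uM// gram_solve//; exact: inj.
apply: smooth_on_mul => //.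
  by apply: smooth_on_mul => //; exact: smooth_on_tr.
apply: smooth_on_inv => //.
  by move=> x Ux; apply: gram_unitmx; exact: inj.
by apply: smooth_on_mul => //; exact: smooth_on_tr.
Qed.

End Smooth.

Section SmoothDifferential.
Variables (R : realType) (n : nat).
Implicit Type U : set 'rV[R]_n.

(** With row vectors, row i of the Jacobian matrix is the i-th partial derivative of g. *)
Lemma smooth_on_jacobian m p U (f : 'rV[R]_n -> 'rV[R]_m) (V : set 'rV[R]_m)
    (g : 'rV[R]_m -> 'rV[R]_p) :
  open U -> open V -> (forall x, U x -> V (f x)) ->
  smooth_on V g -> smooth_on U f -> smooth_on U (fun x => 'J g (f x)).
Proof.
move=> oU oV UV Sg Sf; apply/smooth_on_mxP => // i j.
have SDg : smooth_on V ('D_(delta_mx 0 i) g).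
  by move=> k; exact: ((Sg k.+1).2 i).2.
have /(smooth_on_mxP _ oU)/(_ 0 j) := smooth_on_comp oU oV UV SDg Sf.
apply: eq_smooth_on => // x; rewrite inE => Ux /=.
rewrite derivemxE; last exact: (smooth_on_differentiable oV Sg (UV _ Ux)).
by rewrite -rowE mxE.
Qed.

Lemma smooth_on_diff m p U (f : 'rV[R]_n -> 'rV[R]_m) (V : set 'rV[R]_m)
    (g : 'rV[R]_m -> 'rV[R]_p) (w : 'rV[R]_n -> 'rV[R]_m) :
  open U -> open V -> (forall x, U x -> V (f x)) ->
  smooth_on V g -> smooth_on U f -> smooth_on U w ->
  smooth_on U (fun x => 'd g (f x) (w x)).
Proof.
move=> oU oV UV Sg Sf Sw.
apply: (@eq_smooth_on _ _ _ _ (fun x => w x *m 'J g (f x))) => //.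
  by move=> x _; rewrite mul_rV_lin1.
by apply: smooth_on_mul => //; exact: (smooth_on_jacobian oU oV).
Qed.

End SmoothDifferential.

(** * Tangent vectors in charts *)

Section ManifoldCalculus.
Variable R : realType.
Implicit Types M N : manifold R.

(** Continuity is asked only at the points of U, since chart maps and their inverses are continuous
    only where they are meaningful. *)
Lemma open_preimage_on (T1 T2 : topologicalType) (U : set T1) (A : set T2)
    (f : T1 -> T2) :
  open U -> open A -> (forall x, U x -> {for x, continuous f}) ->
  open (U `&` f @^-1` A).
Proof.
move=> oU oA cf; rewrite openE => x [Ux Afx].
apply: filterI; first exact: open_nbhs_nbhs.
exact: (cf x Ux A (open_nbhs_nbhs (conj oA Afx))).
Qed.

Lemma open_chart_preimage M n (c : chart R M n) (A : set M) :
  open A -> open (cimg c `&` cinv c @^-1` A).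
Proof.
move=> oA; apply: open_preimage_on => //; first exact: cimg_open.
exact: cinv_continuous.
Qed.

Lemma chart_at_dom M (p : M) : cdom (chart_at p) p.
Proof. exact: (projT2 (cid (mcover p))). Qed.

(** Near p, f is the chart at p followed by the local expression of f, and both are continuous. *)
Lemma smooth_map_continuous M N (f : M -> N) : smooth_map f -> continuous f.
Proof.
move=> Sf p; have cp := chart_at_dom p.
have [cf _] := Sf (projT1 (cid (mcover p))).
have cfc : {for p, continuous ((f \o cinv (chart_at p)) \o cmap (chart_at p))}.
  apply: continuous_comp; first exact: cmap_continuous.
  by apply: cf; exact: cmap_img.
rewrite /continuous_at -[X in _ --> f X](cmapK cp).
apply: (cvg_trans _ cfc); apply: near_eq_cvg.
apply: filterS (open_nbhs_nbhs (conj (cdom_open (chart_at p)) cp)) => x cx /=.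
by rewrite cmapK.
Qed.

Lemma smooth_fun_on_differentiable M r (A : set M) (h : M -> 'rV[R]_r)
    (i : mindex M) (p : M) :
  open A -> smooth_fun_on A h -> A p -> cdom (mchart i) p ->
  differentiable (h \o cinv (mchart i)) (cmap (mchart i) p).
Proof.
move=> oA Sh Ap ip; have oV := @open_chart_preimage _ _ (mchart i) _ oA.
apply: (smooth_on_differentiable oV (Sh i)).
by split; [exact: cmap_img|rewrite /preimage /= cmapK].
Qed.

Lemma smooth_fun_cmap M (i : mindex M) :
  smooth_fun_on (cdom (mchart i)) (cmap (mchart i)).
Proof. by move=> j; exact: mcompat. Qed.

Lemma smooth_fun_cmap_comp M N (f : M -> N) (j : mindex N) :
  smooth_map f ->
  smooth_fun_on (f @^-1` cdom (mchart j)) (cmap (mchart j) \o f).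
Proof. by move=> Sf i; exact: (Sf i).2. Qed.

Lemma open_smooth_preimage M N (f : M -> N) (A : set N) :
  smooth_map f -> open A -> open (f @^-1` A).
Proof.
by move=> Sf; move/continuousP: (smooth_map_continuous Sf); exact.
Qed.

(** Around each point a chart j of N is inserted between f and h, which gives a composite of two
    smooth local expressions. *)
Lemma smooth_fun_on_comp M N (f : M -> N) r (A : set N) (h : N -> 'rV[R]_r) :
  smooth_map f -> open A -> smooth_fun_on A h ->
  smooth_fun_on (f @^-1` A) (h \o f).
Proof.
move=> Sf oA Sh i; apply: smooth_on_local => x0 [ix0 Ax0].
have [j jx0] := mcover (f (cinv (mchart i) x0)).
pose V := cimg (mchart i) `&`
  cinv (mchart i) @^-1` (f @^-1` (A `&` cdom (mchart j))).
have oV : open V.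
  apply: open_chart_preimage; apply: open_smooth_preimage => //.
  by apply: openI => //; exact: cdom_open.
exists V => //.
apply: (@eq_smooth_on _ _ _ _ ((h \o cinv (mchart j)) \o
          (cmap (mchart j) \o (f \o cinv (mchart i))))) => //.
  by move=> x; rewrite inE => -[_ [_ jx]] /=; rewrite cmapK.
apply: (smooth_on_comp oV (@open_chart_preimage _ _ (mchart j) _ oA)); last 2 first.
- exact: Sh.
- by apply: smooth_on_sub ((Sf i).2 j) => x [ix [Ax jx]].
- move=> x [ix [Ax jx]] /=; split; first exact: cmap_img.
  by rewrite /preimage /= cmapK.
Qed.

(** Inserting [cinv c \o cmap c], the identity on the domain of c, reduces this to the Euclidean
    chain rule; continuity of phi keeps nearby points in that domain. The point p is kept apart from
    [phi x] because the two are often equal only by a chart cancellation. *)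
Lemma chart_chain n m r N (c : chart R N m) (phi : 'rV[R]_n -> N)
    (h : N -> 'rV[R]_r) (x : 'rV[R]_n) (p : N) :
  phi x = p -> {for x, continuous phi} -> cdom c p ->
  differentiable (cmap c \o phi) x ->
  differentiable (h \o cinv c) (cmap c p) ->
  differentiable (h \o phi) x /\
  forall v, 'd (h \o phi) x v =
    'd (h \o cinv c) (cmap c p) ('d (cmap c \o phi) x v).
Proof.
move=> <- cphi cx dphi dh.
have dcomp : differentiable ((h \o cinv c) \o (cmap c \o phi)) x.
  exact: differentiable_comp.
have nr : {near x, (h \o cinv c) \o (cmap c \o phi) =1 h \o phi}.
  have : nbhs x (phi @^-1` cdom c) :=
    cphi _ (open_nbhs_nbhs (conj (cdom_open c) cx)).
  by apply: filterS => y /= cy; rewrite cmapK.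
have [dhp E] := near_eq_differentiable nr dcomp.
split=> [|v]; first exact: dhp.
have F := congr1 (fun L : _ -> _ => L v) (diff_comp dphi dh).
have G := congr1 (fun L : _ -> _ => L v) E.
exact: (etrans G F).
Qed.

(** Taking for h a chart, or a chart after a map, gives [tangent_coord] and [tangent_map] up to
    conversion, so the lemmas on [tderiv] cover all three. *)
Definition tderiv M r (h : M -> 'rV[R]_r) (p : M) (v : tangent p) : 'rV[R]_r :=
  'd (h \o cinv (chart_at p)) (cmap (chart_at p) p) v.

Lemma tderiv_chart M r (A : set M) (h : M -> 'rV[R]_r) (i : mindex M) (p : M)
    (v : tangent p) :
  open A -> smooth_fun_on A h -> A p -> cdom (mchart i) p ->
  tderiv h v = 'd (h \o cinv (mchart i)) (cmap (mchart i) p) (tangent_coord i v).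
Proof.
move=> oA Sh Ap ip; have cp := chart_at_dom p.
have pE : cinv (chart_at p) (cmap (chart_at p) p) = p by rewrite cmapK.
have [] := @chart_chain _ _ _ _ (mchart i) _ h _ p pE _ ip.
- by apply: cinv_continuous; exact: cmap_img.
- exact: (smooth_fun_on_differentiable (cdom_open _) (smooth_fun_cmap i)).
- exact: (smooth_fun_on_differentiable oA Sh).
- by move=> _ /(_ v).
Qed.

Lemma tderiv_comp M N (f : M -> N) r (A : set N) (h : N -> 'rV[R]_r) (p : M)
    (v : tangent p) :
  smooth_map f -> open A -> smooth_fun_on A h -> A (f p) ->
  tderiv (h \o f) v = tderiv h (tangent_map f v).
Proof.
move=> Sf oA Sh Ap; have cp := chart_at_dom p; have cfp := chart_at_dom (f p).
have pE : (f \o cinv (chart_at p)) (cmap (chart_at p) p) = f p by rewrite /= cmapK.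
have [] := @chart_chain _ _ _ _ (chart_at (f p)) _ h _ _ pE _ cfp.
- apply: continuous_comp; last exact: smooth_map_continuous.
  by apply: cinv_continuous; exact: cmap_img.
- apply: (smooth_fun_on_differentiable _ (smooth_fun_cmap_comp _ Sf)) => //.
  by apply: open_smooth_preimage => //; exact: cdom_open.
- exact: (smooth_fun_on_differentiable oA Sh).
- by move=> _ /(_ v).
Qed.

Lemma diff_chart_id M n (c : chart R M n) (p : M) (v : 'rV[R]_n) : cdom c p ->
  'd (cmap c \o cinv c) (cmap c p) v = v.
Proof.
move=> cp.
have di : differentiable (id : 'rV[R]_n -> _) (cmap c p) by [].
have nr : {near cmap c p, id =1 cmap c \o cinv c}.
  have := open_nbhs_nbhs (conj (@cimg_open _ _ _ c) (cmap_img cp)).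
  by apply: filterS => y /= cy; rewrite cinvK.
have [_ E] := near_eq_differentiable nr di.
by rewrite E diff_val.
Qed.

Lemma tderiv_cmap M (p : M) (v : tangent p) : tderiv (cmap (chart_at p)) v = v.
Proof. exact/diff_chart_id/chart_at_dom. Qed.

(** A tangent vector equals the derivative of [cmap (chart_at p)] along it, and that derivative can
    be computed from the components in chart i. *)
Lemma tangent_coord_inj M (i : mindex M) (p : M) (v w : tangent p) :
  cdom (mchart i) p -> tangent_coord i v = tangent_coord i w -> v = w.
Proof.
move=> ip E; rewrite -(tderiv_cmap v) -(tderiv_cmap w).
have Sc := @smooth_fun_cmap M (projT1 (cid (mcover p))).
by rewrite !(tderiv_chart _ (cdom_open _) Sc (chart_at_dom p) ip) E.
Qed.

Lemma tangent_coord_surj M (i : mindex M) (p : M) (w : 'rV[R]_(mdim M)) :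
  cdom (mchart i) p -> exists v : tangent p, tangent_coord i v = w.
Proof.
(* The witness is w carried by the differential of the transition map from chart i to
   [chart_at p]. *)
move=> ip; exists ('d (cmap (chart_at p) \o cinv (mchart i)) (cmap (mchart i) p) w).
have cp := chart_at_dom p.
have [] := @chart_chain _ _ _ _ (chart_at p) _ (cmap (mchart i)) _ _ (cmapK ip) _ cp.
- by apply: cinv_continuous; exact: cmap_img.
- exact: (smooth_fun_on_differentiable (cdom_open _) (@smooth_fun_cmap M _)).
- exact: (smooth_fun_on_differentiable (cdom_open _) (@smooth_fun_cmap M i)).
move=> _ /(_ w) wE; rewrite [LHS](esym wE); exact: diff_chart_id.
Qed.

End ManifoldCalculus.

(** * Local trivializations *)

Section RowMx.
Variables (R : realType) (n p q : nat).

Lemma continuous_lsubmx : continuous (lsubmx : 'rV[R]_(p + q) -> 'rV[R]_p).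
Proof. by move=> x; apply/differentiable_continuous/differentiable_lsubmx. Qed.

Lemma continuous_rsubmx : continuous (rsubmx : 'rV[R]_(p + q) -> 'rV[R]_q).
Proof. by move=> x; apply/differentiable_continuous/differentiable_rsubmx. Qed.

Lemma diff_lsubmx (x v : 'rV[R]_(p + q)) :
  'd (lsubmx : 'rV[R]_(p + q) -> 'rV[R]_p) x v = lsubmx v.
Proof. by rewrite diff_lin//; exact: continuous_lsubmx. Qed.

Lemma diff_rsubmx (x v : 'rV[R]_(p + q)) :
  'd (rsubmx : 'rV[R]_(p + q) -> 'rV[R]_q) x v = rsubmx v.
Proof. by rewrite diff_lin//; exact: continuous_rsubmx. Qed.

Lemma differentiable_row_mx (f : 'rV[R]_n -> 'rV[R]_p)
    (g : 'rV[R]_n -> 'rV[R]_q) x :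
  differentiable f x -> differentiable g x ->
  differentiable (fun y => row_mx (f y) (g y)) x.
Proof.
move=> df dg; apply: differentiable_mx => j; under eq_fun do rewrite mxE.
case: (fintype.split j) => l.
  exact: (differentiable_comp df (differentiable_coord _ _ _)).
exact: (differentiable_comp dg (differentiable_coord _ _ _)).
Qed.

Lemma diff_row_mx (f : 'rV[R]_n -> 'rV[R]_p) (g : 'rV[R]_n -> 'rV[R]_q) x v :
  differentiable f x -> differentiable g x ->
  'd (fun y => row_mx (f y) (g y)) x v = row_mx ('d f x v) ('d g x v).
Proof.
move=> df dg; have dF := differentiable_row_mx df dg.
set F := fun y => row_mx (f y) (g y).
rewrite -[LHS]hsubmxK; congr row_mx.
  have -> : f = lsubmx \o F by apply/funext => y; rewrite /F/= row_mxKl.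
  by rewrite (diff_comp dF (differentiable_lsubmx (F x)))/= diff_lsubmx.
have -> : g = rsubmx \o F by apply/funext => y; rewrite /F/= row_mxKr.
by rewrite (diff_comp dF (differentiable_rsubmx (F x)))/= diff_rsubmx.
Qed.

End RowMx.

Section Trivialization.
Variables (R : realType) (E : vbundle R) (U : set (vbase E)).
Variables (phi : E -> 'rV[R]_(vrank E)) (s : vbase E -> 'rV[R]_(vrank E) -> E).
Hypothesis triv :
  local_trivialization (@vproj R E) (@vadd R E) (@vscale R E) U phi s.

Let Q := vbase E.
Let r := vrank E.

Lemma open_triv_total : open (@vproj R E @^-1` U).
Proof.
by apply: open_smooth_preimage; [exact: proj_smooth|exact: lt_open triv].
Qed.

(** On the fibre over q, [s q] is the inverse of the linear map [phi]. *)
Lemma triv_linear q (c : R) (y y' : 'rV[R]_r) : U q ->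
  s q (c *: y + y') = vadd (vscale c (s q y)) (s q y').
Proof.
move=> Uq; have pE y1 := lt_proj triv y1 Uq.
have pZ : vproj (vscale c (s q y)) = q by rewrite proj_scale pE.
have pD : vproj (vadd (vscale c (s q y)) (s q y')) = q.
  by rewrite proj_add pZ ?pE.
rewrite -[RHS](lt_sK triv) ?pD//; congr (s q _).
rewrite (lt_add triv) ?pZ ?pE// (lt_scale triv) ?pE//.
by rewrite !(lt_phiK triv).
Qed.

Variables (a : E) (Ua : U (vproj a)).

Let c : chart R Q (mdim Q) := chart_at (vproj a).

Definition triv_param (z : 'rV[R]_(mdim Q + r)) : E :=
  s (cinv c (lsubmx z)) (rsubmx z).

Definition triv_base : 'rV[R]_(mdim Q + r) := row_mx (cmap c (vproj a)) (phi a).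

Let D := [set z : 'rV[R]_(mdim Q + r) |
  cimg c (lsubmx z) /\ U (cinv c (lsubmx z))].

Lemma triv_param_base : triv_param triv_base = a.
Proof.
rewrite /triv_param /triv_base row_mxKl row_mxKr cmapK; last exact: chart_at_dom.
exact: (lt_sK triv).
Qed.

Let D0 : D triv_base.
Proof.
rewrite /D/= /triv_base row_mxKl; split; first exact/cmap_img/chart_at_dom.
by rewrite cmapK//; exact: chart_at_dom.
Qed.

Let oD : open D.
Proof.
have oA : open (cimg c `&` cinv c @^-1` U).
  by apply: open_chart_preimage; exact: lt_open triv.
by move/continuousP: (@continuous_lsubmx R (mdim Q) r) => /(_ _ oA).
Qed.

Let nD : nbhs triv_base D.
Proof. exact: open_nbhs_nbhs. Qed.

Let Sinto : smooth_into D triv_param.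
Proof. exact: (lt_smooth_inv triv (projT1 (cid (mcover (vproj a))))). Qed.

Let dparam :
  differentiable (cmap (chart_at a) \o triv_param) triv_base.
Proof.
have /= Sj := Sinto.2 (projT1 (cid (mcover a))).
apply: (smooth_on_differentiable _ Sj).
  by apply: open_preimage_on => //; [exact: cdom_open|exact: Sinto.1].
by split => //; rewrite /preimage/= triv_param_base; exact: chart_at_dom.
Qed.

(** The tangent vector with bundle coordinates (v, y). Bundle coordinates need not be a chart of the
    atlas of E, so they are transported to [chart_at a], in which tangent vectors are
    represented. *)
Definition triv_lift (v : 'rV[R]_(mdim Q)) (y : 'rV[R]_r) : tangent a :=
  'd (cmap (chart_at a) \o triv_param) triv_base (row_mx v y).

Lemma tderiv_triv_lift p (A : set E) (h : E -> 'rV[R]_p) v y :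
  open A -> smooth_fun_on A h -> A a ->
  differentiable (h \o triv_param) triv_base /\
  tderiv h (triv_lift v y) = 'd (h \o triv_param) triv_base (row_mx v y).
Proof.
move=> oA Sh Aa.
have ca := chart_at_dom a.
have [] := @chart_chain _ _ _ _ _ (chart_at a) _ h _ _ triv_param_base _ ca dparam.
- exact: Sinto.1.
- exact: (smooth_fun_on_differentiable oA Sh Aa).
- by move=> dh /(_ (row_mx v y)) E1; split.
Qed.

(** In bundle coordinates the projection is the linear map [lsubmx], which is its own
    differential. *)
Lemma tangent_map_triv_lift v y :
  tangent_map (@vproj R E) (triv_lift v y) = v.
Proof.
have Sc := smooth_fun_cmap_comp (projT1 (cid (mcover (vproj a)))) (@proj_smooth R E).
have [|_ ] := tderiv_triv_lift v y _ Sc (chart_at_dom _).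
  by apply: open_smooth_preimage; [exact: proj_smooth|exact: cdom_open].
rewrite -[tderiv _ _]/(tangent_map (@vproj R E) (triv_lift v y)) => ->.
have nr : {near triv_base, (lsubmx : 'rV[R]_(mdim Q + r) -> _) =1
   (cmap c \o @vproj R E) \o triv_param}.
  apply: filterS nD => z -[cz Uz] /=.
  by rewrite /triv_param (lt_proj triv)// cinvK.
have [_ E1] := near_eq_differentiable nr (differentiable_lsubmx _).
have := congr1 (fun L : _ -> _ => L (row_mx v y)) E1 => /= ->.
by rewrite diff_lsubmx row_mxKl.
Qed.

(** Near [x0], [triv_param] after the local expression [T] of the pair (projection, [phi]) is the
    identity in [chart_at a]; the claim is its differential. *)
Lemma triv_liftK (u : tangent a) :
  triv_lift (tangent_map (@vproj R E) u) (tderiv phi u) = u.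
Proof.
pose x0 := cmap (chart_at a) a.
pose T1 := cmap c \o @vproj R E \o cinv (chart_at a).
pose T2 := phi \o cinv (chart_at a).
pose T x := row_mx (T1 x) (T2 x).
have ca := chart_at_dom a; have cq := chart_at_dom (vproj a).
have dT1 : differentiable T1 x0.
  have Sc := smooth_fun_cmap_comp (projT1 (cid (mcover (vproj a)))) (@proj_smooth R E).
  apply: (smooth_fun_on_differentiable _ Sc) => //.
  by apply: open_smooth_preimage; [exact: proj_smooth|exact: cdom_open].
have dT2 : differentiable T2 x0.
  exact: (smooth_fun_on_differentiable open_triv_total (lt_smooth triv) Ua ca).
have TE : T x0 = triv_base by rewrite /T /T1 /T2/= /x0 cmapK.
have dT : differentiable T x0 by exact: differentiable_row_mx.
have dP : differentiable (cmap (chart_at a) \o triv_param) (T x0) by rewrite TE.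
have dcomp := diff_comp dT dP.
have nr : {near x0, id =1 (cmap (chart_at a) \o triv_param) \o T}.
  pose B := cdom (chart_at a) `&` @vproj R E @^-1` (U `&` cdom c).
  have oB : open B.
    apply: openI; first exact: cdom_open.
    apply: open_smooth_preimage; first exact: proj_smooth.
    by apply: openI; [exact: lt_open triv|exact: cdom_open].
  have oV := @open_chart_preimage _ _ _ (chart_at a) _ oB.
  apply: filterS (open_nbhs_nbhs (conj oV _)).
    move=> x [ix [_ [Ux cx]]] /=.
    rewrite /triv_param /T row_mxKl row_mxKr /T1 /T2 /= cmapK//.
    by rewrite (lt_sK triv)// cinvK.
  split; first exact: cmap_img.
  by rewrite /preimage/= /x0 cmapK.
have [_ E1] := near_eq_differentiable nr (ex_diff (is_diff_def := is_diff_id x0)).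
have := congr1 (fun L : _ -> _ => L u) (etrans (esym dcomp) E1).
rewrite diff_val /= TE => uE; rewrite -[RHS]uE /triv_lift; congr ('d _ _ _).
exact: (esym (diff_row_mx u dT1 dT2)).
Qed.

(** A vertical vector is the velocity of an affine line in the fibre, and a linear function has
    constant difference quotients along such a line. *)
Lemma tderiv_vertical p (A : set E) (h : E -> 'rV[R]_p) w :
  open A -> smooth_fun_on A h -> A a ->
  (forall t y y', h (s (vproj a) (t *: y + y')) =
     t *: h (s (vproj a) y) + h (s (vproj a) y')) ->
  tderiv h (triv_lift 0 w) = h (s (vproj a) w).
Proof.
move=> oA Sh Aa hlin; have [dh ->] := tderiv_triv_lift 0 w oA Sh Aa.
rewrite -deriveE//; apply: cvg_lim => //.
have qE0 : cinv c (lsubmx triv_base) = vproj a.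
  by rewrite /triv_base row_mxKl cmapK//; exact: chart_at_dom.
have qE t : cinv c (lsubmx (t *: row_mx 0 w + triv_base)) = vproj a.
  by rewrite linearD linearZ /= row_mxKl scaler0 add0r qE0.
have yE t : rsubmx (t *: row_mx 0 w + triv_base) = t *: w + rsubmx triv_base.
  by rewrite linearD linearZ /= row_mxKr.
have -> : (fun t : R => t^-1 *: (((h \o triv_param) \o shift triv_base)
     (t *: row_mx 0 w) - (h \o triv_param) triv_base)) =
   (fun t => (t^-1 * t) *: h (s (vproj a) w)).
  apply/funext => t /=; rewrite /triv_param qE qE0 yE.
  by rewrite hlin addrK scalerA.
apply: cvg_near_cst; near=> t; rewrite mulVf ?scale1r//.
by near: t; exact: nbhs_dnbhs_neq.
Unshelve. all: by end_near. Qed.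

End Trivialization.

(** * Fiberwise bijective morphisms *)

Section Morphism.
Variables (R : realType) (E1 E2 : lie_algebroid R).
Variables (Psi : E1 -> E2) (psi : vbase E1 -> vbase E2).
Hypothesis Psi_mor : la_morphism Psi psi.
Hypothesis Psi_bij : fiberwise_bijective Psi psi.

Lemma morphism_inj a a' : vproj a = vproj a' -> Psi a = Psi a' -> a = a'.
Proof.
move=> qE PE; have [_ inj _] := Psi_bij (vproj a').
by apply: inj; rewrite ?inE.
Qed.

Variables (U2 : set (vbase E2)) (phi2 : E2 -> 'rV[R]_(vrank E2)).
Variable s2 : vbase E2 -> 'rV[R]_(vrank E2) -> E2.
Hypothesis triv2 :
  local_trivialization (@vproj R E2) (@vadd R E2) (@vscale R E2) U2 phi2 s2.

Let A := @vproj R E2 @^-1` U2.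

Let oA : open A.
Proof. exact: (open_triv_total triv2). Qed.

Let S2 : smooth_fun_on A phi2.
Proof. exact: lt_smooth triv2. Qed.

Let oPA : open (Psi @^-1` A).
Proof. by apply: open_smooth_preimage => //; exact: mor_smooth Psi_mor. Qed.

Let SP : smooth_fun_on (Psi @^-1` A) (phi2 \o Psi).
Proof. by apply: smooth_fun_on_comp => //; exact: mor_smooth Psi_mor. Qed.

Section Fibre.
Variables (U1 : set (vbase E1)) (phi1 : E1 -> 'rV[R]_(vrank E1)).
Variable s1 : vbase E1 -> 'rV[R]_(vrank E1) -> E1.
Hypothesis triv1 :
  local_trivialization (@vproj R E1) (@vadd R E1) (@vscale R E1) U1 phi1 s1.
Variables (a : E1) (Ua : U1 (vproj a)) (Aa : A (Psi a)).

Let q := vproj a.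

Let U2q : U2 (psi q).
Proof. by move: Aa; rewrite /A /preimage/= (mor_proj Psi_mor). Qed.

(** The map from y to [phi2 (Psi (s1 q y))] is the fibre matrix of [Psi] in the two trivializations,
    a composite of three maps linear on fibres. *)
Lemma fibre_coord_linear t y y' :
  phi2 (Psi (s1 q (t *: y + y'))) =
  t *: phi2 (Psi (s1 q y)) + phi2 (Psi (s1 q y')).
Proof.
have pE y1 : vproj (s1 q y1) = q := lt_proj triv1 y1 Ua.
have PE b : vproj (Psi b) = psi (vproj b) := mor_proj Psi_mor b.
rewrite (triv_linear triv1)// (mor_add Psi_mor) ?proj_scale ?pE//.
rewrite (mor_scale Psi_mor) (lt_add triv2) ?proj_scale ?PE ?pE//.
by rewrite (lt_scale triv2) ?PE ?pE.
Qed.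

(** Both y and 0 are sent by [Psi] to the point [s2 (psi q) 0], and [Psi] is injective on the
    fibre. *)
Lemma fibre_coord_eq0 y : phi2 (Psi (s1 q y)) = 0 -> y = 0.
Proof.
move=> y0.
have pE y1 : vproj (s1 q y1) = q := lt_proj triv1 y1 Ua.
have z0 : phi2 (Psi (s1 q 0)) = 0.
  have := fibre_coord_linear (-1) 0 0.
  by rewrite scaler0 addr0 scaleN1r addNr.
have PsE y1 : phi2 (Psi (s1 q y1)) = 0 -> Psi (s1 q y1) = s2 (psi q) 0.
  by move=> <-; rewrite -[LHS](lt_sK triv2) (mor_proj Psi_mor) pE.
rewrite -(lt_phiK triv1 y Ua) -[RHS](lt_phiK triv1 0 Ua); congr phi1.
apply: morphism_inj; first exact: (etrans (pE y) (esym (pE 0))).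
exact: (etrans (PsE _ y0) (esym (PsE _ z0))).
Qed.

Lemma fibre_coord_surj y : exists y1, phi2 (Psi (s1 q y1)) = y.
Proof.
have [_ _ surj] := Psi_bij q.
have /surj[b /= bq bE] : [set b : E2 | vproj b = psi q] (s2 (psi q) y).
  exact: (lt_proj triv2).
exists (phi1 b); rewrite -bq (lt_sK triv1) ?bq// bE.
exact: (lt_phiK triv2).
Qed.

Let lift := @triv_lift R E1 phi1 s1 a.

(** Zero projection makes u vertical, with fibre part w = d phi1 (u); then d (phi2 o Psi)(u) is the
    image of w under the injective fibre matrix. *)
Lemma tangent_morphism_eq0_aux (u : tangent a) :
  tangent_map (@vproj R E1) u = 0 :> 'rV[R]_(mdim (vbase E1)) ->
  tderiv (phi2 \o Psi) u = 0 -> u = 0 :> 'rV[R]_(mdim E1).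
Proof.
move=> u1 u2.
have uE := triv_liftK triv1 Ua u; rewrite u1 in uE.
have := tderiv_vertical triv1 Ua (tderiv phi1 u) oPA SP Aa fibre_coord_linear.
rewrite uE u2 => /esym/fibre_coord_eq0 w0.
by rewrite -uE w0 /triv_lift row_mx0 linear0.
Qed.

Lemma tangent_morphism_surj_aux (v : 'rV[R]_(mdim (vbase E1))) y :
  exists u : tangent a, tangent_map (@vproj R E1) u = v /\
    tderiv (phi2 \o Psi) u = y.
Proof.
(* The vector [lift v 0] has the right projection; the vertical vector [lift 0 w] corrects its
   second component without changing the first. *)
have [w wE] := fibre_coord_surj (y - tderiv (phi2 \o Psi) (lift v 0)).
exists (lift v w); split; first exact: (tangent_map_triv_lift triv1).
have liftE : lift v w = lift v 0 + lift 0 w :> 'rV[R]_(mdim E1).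
  by rewrite /lift /triv_lift -linearD add_row_mx add0r addr0.
have vE := tderiv_vertical triv1 Ua w oPA SP Aa fibre_coord_linear.
have -> : tderiv (phi2 \o Psi) (lift v w) =
    tderiv (phi2 \o Psi) (lift v 0) + tderiv (phi2 \o Psi) (lift 0 w).
  by rewrite /tderiv liftE linearD.
by rewrite [tderiv _ (lift 0 w)](etrans vE wE) addrC subrK.
Qed.

End Fibre.

Lemma tangent_morphism_eq0 (a : E1) (u : tangent a) : A (Psi a) ->
  tangent_map (@vproj R E1) u = 0 :> 'rV[R]_(mdim (vbase E1)) ->
  tderiv (phi2 \o Psi) u = 0 -> u = 0 :> 'rV[R]_(mdim E1).
Proof.
move=> Aa; have [U1 [phi1 [s1 [Ua triv1]]]] := locally_trivial (vproj a).
exact: (tangent_morphism_eq0_aux triv1).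
Qed.

Lemma tangent_morphism_surj (a : E1) (v : 'rV[R]_(mdim (vbase E1))) y :
  A (Psi a) -> exists u : tangent a, tangent_map (@vproj R E1) u = v /\
    tderiv (phi2 \o Psi) u = y.
Proof.
move=> Aa; have [U1 [phi1 [s1 [Ua triv1]]]] := locally_trivial (vproj a).
exact: (tangent_morphism_surj_aux triv1).
Qed.

End Morphism.

(** * Lifting tangent vectors and vector fields through the morphism *)

Lemma tderivB (R : realType) (M : manifold R) r (h : M -> 'rV[R]_r) (p : M)
    (v w : 'rV[R]_(mdim M)) :
  tderiv h (v - w : tangent p) =
  tderiv h (v : tangent p) - tderiv h (w : tangent p).
Proof. exact: linearB. Qed.

Section Lift.
Variables (R : realType) (E1 E2 : lie_algebroid R).
Variables (Psi : E1 -> E2) (psi : vbase E1 -> vbase E2).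
Hypothesis Psi_mor : la_morphism Psi psi.
Hypothesis Psi_bij : fiberwise_bijective Psi psi.

(** This is the derivative of tau2 o Psi = psi o tau1 along u. *)
Lemma tangent_proj_morphism (a : E1) (u : tangent a) :
  tangent_map (@vproj R E2) (tangent_map Psi u) =
  tangent_map psi (tangent_map (@vproj R E1) u) :> 'rV[R]_(mdim (vbase E2)).
Proof.
have S1 := smooth_fun_cmap_comp
  (projT1 (cid (mcover (vproj (Psi a))))) (@proj_smooth R E2).
have o1 : open (@vproj R E2 @^-1` cdom (chart_at (vproj (Psi a)))).
  by apply: open_smooth_preimage; [exact: proj_smooth|exact: cdom_open].
have S2 := smooth_fun_cmap_comp
  (projT1 (cid (mcover (psi (vproj a))))) (mor_base_smooth Psi_mor).
have o2 : open (psi @^-1` cdom (chart_at (psi (vproj a)))).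
  by apply: open_smooth_preimage; [exact: mor_base_smooth Psi_mor|exact: cdom_open].
have E1' := tderiv_comp u (mor_smooth Psi_mor) o1 S1 (chart_at_dom _).
have E2' := tderiv_comp u (@proj_smooth R E1) o2 S2 (chart_at_dom _).
transitivity (tderiv ((cmap (chart_at (vproj (Psi a))) \o @vproj R E2) \o Psi) u).
  exact: (esym E1').
transitivity (tderiv ((cmap (chart_at (psi (vproj a))) \o psi) \o @vproj R E1) u).
  (* The rewriting also identifies the base points [vproj (Psi a)] and [psi (vproj a)], hence the
     charts selected at them. *)
  congr (tderiv _ u); apply/funext => b /=.
  by rewrite !(mor_proj Psi_mor).
exact: E2'.
Qed.

(** The difference u - u' has zero projection, and d (phi2 o Psi) vanishes on it because it factors
    through T Psi. *)
Lemma tangent_lift_unique (a : E1) (u u' : tangent a) :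
  tangent_map (@vproj R E1) u = tangent_map (@vproj R E1) u' ->
  tangent_map Psi u = tangent_map Psi u' -> u = u'.
Proof.
move=> tE PE.
have [U2 [phi2 [s2 [Ub triv2]]]] := locally_trivial (vproj (Psi a)).
apply/eqP; rewrite -subr_eq0; apply/eqP.
have hE (w : tangent a) := tderiv_comp w (mor_smooth Psi_mor)
  (open_triv_total triv2) (lt_smooth triv2) Ub.
apply: (tangent_morphism_eq0 Psi_mor Psi_bij triv2 (a := a)) => //.
  apply: (etrans (@tderivB _ _ _ (cmap (chart_at (vproj a)) \o @vproj R E1) a u u')).
  by apply/eqP; rewrite subr_eq0; exact/eqP.
apply: (etrans (@tderivB _ _ _ (phi2 \o Psi) a u u')).
by apply/eqP; rewrite subr_eq0 (hE u) (hE u') PE.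
Qed.

Lemma tangent_lift_exists (a : E1) (w : tangent (Psi a)) :
  tangent_map (@vproj R E2) w = anchor (Psi a) ->
  exists u : tangent a, tangent_map (@vproj R E1) u = anchor a /\
    tangent_map Psi u = w.
Proof.
move=> wE.
have [U2 [phi2 [s2 [Ub triv2]]]] := locally_trivial (vproj (Psi a)).
have [u [tu hu]] := tangent_morphism_surj Psi_mor Psi_bij triv2 (anchor a)
  (tderiv phi2 w) Ub.
exists u; split => //.
(* The two vectors are compared in bundle coordinates: the fibre parts agree by the choice of u, the
   base parts by T psi o rho1 = rho2 o Psi. *)
rewrite -(triv_liftK triv2 Ub w) -(triv_liftK triv2 Ub (tangent_map Psi u)).
have hE := tderiv_comp u (mor_smooth Psi_mor)
  (open_triv_total triv2) (lt_smooth triv2) Ub.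
rewrite -hE hu wE; congr (triv_lift _ _ _ _ _).
by rewrite (tangent_proj_morphism u) tu -(mor_anchor Psi_mor).
Qed.

(** The pointwise equations alone force smoothness: in chart i, the components of [Gamma1] solve a
    linear system whose matrix is the Jacobian of [F], the local expression of (tau1, phi2 o
    Psi). *)
Lemma tangent_lift_smooth (Gamma1 : forall a : E1, tangent a)
    (Gamma2 : forall b : E2, tangent b) : vector_field Gamma2 ->
  (forall a, tangent_map (@vproj R E1) (Gamma1 a) = anchor a) ->
  (forall a, tangent_map Psi (Gamma1 a) = Gamma2 (Psi a)) ->
  vector_field Gamma1.
Proof.
move=> SG2 tG PG i j; apply: smooth_on_local => x0 [ix0 jx0].
pose a0 := cinv (mchart i) x0.
have [c ca0] := mcover (vproj a0).
have [e ea0] := mcover (Psi a0).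
have [U2 [phi2 [s2 [Ub triv2]]]] := locally_trivial (vproj (Psi a0)).
have SPsi := mor_smooth Psi_mor; have Stau := @proj_smooth R E1.
pose A := @vproj R E2 @^-1` U2.
have oA : open A := open_triv_total triv2.
have oPA : open (Psi @^-1` A) by exact: open_smooth_preimage.
have oc : open (@vproj R E1 @^-1` cdom (mchart c)).
  by apply: open_smooth_preimage => //; exact: cdom_open.
have oe : open (Psi @^-1` cdom (mchart e)).
  by apply: open_smooth_preimage => //; exact: cdom_open.
(* Points at which all the charts and the trivialization chosen around [x0] are available: i and j
   on [E1], c on its base, e and [triv2] on the side of [E2]. *)
pose B := (cdom (mchart i) `&` cdom (mchart j)) `&`
  ((@vproj R E1 @^-1` cdom (mchart c)) `&`
   (Psi @^-1` A `&` Psi @^-1` cdom (mchart e))).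
have oB : open B.
  by do 3?[apply: openI => //]; exact: cdom_open.
pose V := cimg (mchart i) `&` cinv (mchart i) @^-1` B.
have oV : open V := @open_chart_preimage _ _ _ (mchart i) _ oB.
exists V; first by do 3?split => //; exact: cinv_dom.
pose f1 := (cmap (mchart c) \o @vproj R E1) \o cinv (mchart i).
pose f2 := (phi2 \o Psi) \o cinv (mchart i).
pose F x := row_mx (f1 x) (f2 x).
have Sf1 : smooth_on V f1.
  by apply: smooth_on_sub (smooth_fun_cmap_comp c Stau i) => x [ix [_ [cx _]]].
have Sf2 : smooth_on V f2.
  apply: smooth_on_sub (smooth_fun_on_comp SPsi oA (lt_smooth triv2) i).
  by move=> x [ix [_ [_ [Ax _]]]].
have SF : smooth_on V F by exact: smooth_on_row_mx.
have dF x (v : 'rV[R]_(mdim E1)) : V x ->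
    'd F x v = row_mx ('d f1 x v) ('d f2 x v).
  by move=> Vx; apply: diff_row_mx; exact: (smooth_on_differentiable oV _ Vx).
pose G x := tangent_coord i (Gamma1 (cinv (mchart i) x)).
have d1 x (u : tangent (cinv (mchart i) x)) : V x ->
    'd f1 x (tangent_coord i u) = tangent_coord c (tangent_map (@vproj R E1) u).
  move=> [ix [[idx _] [cx _]]].
  have := tderiv_chart u oc (smooth_fun_cmap_comp c Stau) cx idx.
  rewrite cinvK// => <-.
  exact: (tderiv_comp u Stau (cdom_open _) (smooth_fun_cmap c) cx).
have d2 x (u : tangent (cinv (mchart i) x)) : V x ->
    'd f2 x (tangent_coord i u) = tderiv (phi2 \o Psi) u.
  move=> [ix [[idx _] [_ [Ax _]]]].
  have := tderiv_chart u oPA (smooth_fun_on_comp SPsi oA (lt_smooth triv2)) Ax idx.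
  by rewrite cinvK.
pose fe := cmap (mchart e) \o (Psi \o cinv (mchart i)).
have Sfe : smooth_on V fe.
  by apply: smooth_on_sub ((SPsi i).2 e) => x [ix [_ [_ [_ ex]]]].
pose ve (b : E2) := tangent_coord e (Gamma2 b).
have Sve : smooth_on V (ve \o (Psi \o cinv (mchart i))).
  (* [Gamma2] is read in chart e at both source and target, then composed with the local expression
     [fe] of [Psi]. *)
  apply: (@eq_smooth_on _ _ _ _ ((ve \o cinv (mchart e)) \o fe)) => //.
    by move=> x; rewrite inE => -[ix [_ [_ [_ ex]]]] /=; rewrite cmapK.
  have oe' := @open_chart_preimage _ _ _ (mchart e) _ (@cdom_open _ _ _ (mchart e)).
  apply: (smooth_on_comp oV oe' _ (SG2 e e)) => //.
  move=> x [ix [_ [_ [_ ex]]]]; split; first exact: cmap_img.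
  by rewrite /preimage /= cmapK.
have SG : smooth_on V G.
  apply: (@smooth_on_solve _ _ _ _ _ (fun x => 'J F x) (fun x => 'd F x (G x))) => //.
  - by apply: (smooth_on_jacobian oV oV _ SF (smooth_on_id oV)).
  (* The right-hand side, defined from [G], is rewritten without it: its blocks are the anchor of
     [E1] and d phi2 applied to [Gamma2] along [Psi], both known to be smooth. *)
  - apply: (@eq_smooth_on _ _ _ _ (fun x =>
      row_mx (tangent_coord c (anchor (cinv (mchart i) x)))
        ('d (phi2 \o cinv (mchart e)) (fe x) (ve (Psi (cinv (mchart i) x)))))) => //.
      move=> x; rewrite inE => Vx; rewrite dF// d1// d2// tG; congr row_mx.
      have [ix [_ [_ [Ax ex]]]] := Vx.
      rewrite (tderiv_comp _ SPsi oA (lt_smooth triv2) Ax) PG.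
      exact: (esym (tderiv_chart _ oA (lt_smooth triv2) Ax ex)).
    apply: smooth_on_row_mx => //.
      by apply: smooth_on_sub (@anchor_smooth R E1 i c) => x [ix [_ [cx _]]].
    have oAe := @open_chart_preimage _ _ _ (mchart e) _ oA.
    apply: (smooth_on_diff oV oAe _ (lt_smooth triv2 e)) => //.
    move=> x [ix [_ [_ [Ax ex]]]]; split; first exact: cmap_img.
    by rewrite /preimage /= cmapK.
  (* A kernel vector v consists of the components of some tangent vector u that
     [tangent_morphism_eq0] forces to vanish. *)
  - move=> x Vx v; rewrite mul_rV_lin1 => v0.
    have [ix [[idx _] [cx [Ax ex]]]] := Vx.
    have [u uE] := tangent_coord_surj v idx.
    move: v0; rewrite dF// -uE d1// d2// -[0]row_mx0 => /eq_row_mx[u1 u2].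
    have u0 : u = 0 :> 'rV[R]_(mdim E1).
      apply: (tangent_morphism_eq0 Psi_mor Psi_bij triv2 Ax _ u2).
      apply: (tangent_coord_inj cx); rewrite u1.
      exact: (esym (linear0 _)).
    by rewrite u0 /tangent_coord linear0.
  - by move=> x Vx; rewrite mul_rV_lin1.
(* The components in chart j come from [G], those in chart i, through the differential of the
   transition map. *)
apply: (@eq_smooth_on _ _ _ _ (fun x =>
    'd (cmap (mchart j) \o cinv (mchart i)) x (G x))) => //.
  move=> x; rewrite inE => -[ix [[idx jdx] _]].
  have := tderiv_chart (Gamma1 (cinv (mchart i) x)) (cdom_open _)
            (smooth_fun_cmap j) jdx idx.
  by rewrite cinvK// => E; exact: (esym E).
have oij := @open_chart_preimage _ _ _ (mchart i) _ (@cdom_open _ _ _ (mchart j)).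
apply: (smooth_on_diff oV oij _ (smooth_fun_cmap j i) (smooth_on_id oV)) => //.
by move=> x [ix [[_ jdx] _]].
Qed.

End Lift.

Theorem proposition3p2 (R : realType) (E1 E2 : lie_algebroid R)
    (Psi : E1 -> E2) (psi : vbase E1 -> vbase E2)
    (Psi_morphism : la_morphism Psi psi)
    (Psi_bijective : fiberwise_bijective Psi psi)
    (Gamma2 : forall b : E2, tangent b) (Gamma2_sode : sode Gamma2) :
  exists! Gamma1 : forall a : E1, tangent a,
    sode Gamma1 /\
    (forall a : E1, tangent_map Psi (Gamma1 a) = Gamma2 (Psi a)).
Proof.
have [Gamma2_smooth Gamma2_anchor] := Gamma2_sode.
have lift (a : E1) : exists u : tangent a,
    tangent_map (@vproj R E1) u = anchor a /\ tangent_map Psi u = Gamma2 (Psi a).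
  exact: (tangent_lift_exists Psi_morphism Psi_bijective (Gamma2_anchor _)).
(* The vectors are chosen separately at each point; smoothness is then deduced from the equations
   they satisfy. *)
pose Gamma1 (a : E1) : tangent a := projT1 (cid (lift a)).
have Gamma1P a := projT2 (cid (lift a)) : _ (Gamma1 a).
exists Gamma1; split.
  split=> [|a]; last exact: (Gamma1P a).2.
  split=> [|a]; last exact: (Gamma1P a).1.
  apply: (tangent_lift_smooth Psi_morphism Psi_bijective Gamma2_smooth) => a.
    exact: (Gamma1P a).1.
  exact: (Gamma1P a).2.
move=> Gamma [[_ Gamma_anchor] GammaP].
apply: functional_extensionality_dep => a.
apply: (tangent_lift_unique Psi_morphism Psi_bijective).
  by rewrite Gamma_anchor (Gamma1P a).1.
by rewrite GammaP (Gamma1P a).2.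
Qed.
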